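(* Let $\mathbb{F}$ be a field with $\mathrm{char}(\mathbb{F})\ne 2$, and let $(C_2\times C_2)\rtimes C_4$ be the semidirect product (not direct) of the Klein four-group with a cyclic group of order $4$, in which a generator of $C_4$ acts on $C_2\times C_2=\langle a\rangle\times\langle b\rangle$ by interchanging $a$ and $b$. Then $\beta((C_2\times C_2)\rtimes C_4)=6$.
   Context: The group in question has order $16$ and is GAP's SmallGroup(16,3). For a finite group $G$, a $G$-module is a finite dimensional $\mathbb{F}$-vector space $V$ with a linear action of $G$. $S(V)$ is the symmetric algebra of $V$ (a polynomial algebra on a basis of $V$, with each variable of degree one), on which $G$ acts by $\mathbb{F}$-algebra automorphisms extending the action on $V$, and $S(V)^G$ is the subalgebra of $G$-invariants. $\beta(S(V)^G)$ is the minimal non-negative integer $d$ such that the $\mathbb{F}$-algebra $S(V)^G$ is generated by its homogeneous components of degree at most $d$. The Noether number is $\beta(G)=\sup\{\beta(S(V)^G): V \text{ is a } G\text{-module over }\mathbb{F}\}$. *)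

(* Defs.v *)
From mathcomp Require Import all_boot all_order all_algebra.
From mathcomp Require Import all_fingroup all_solvable all_character.
From mathcomp Require Export mpoly.

Set Implicit Arguments.
Unset Strict Implicit.
Unset Printing Implicit Defensive.

Import GRing.Theory.

Local Open Scope ring_scope.

Section Invariants.

Variables (F : fieldType) (gT : finGroupType) (G : {group gT}).

Section OneModule.

(* The G-module V is 'rV[F]_n, on which g acts by v |-> v *m rG g, and
   S(V) is {mpoly F[n]}, whose variable 'X_i is the i-th standard basis vector
   of V; g maps that vector to the i-th row of rG g. This is a right action:
   a left G-module is recovered with g^-1, which leaves the invariants
   unchanged. *)
Variables (n : nat) (rG : mx_representation F G n).

Definition sym_act (g : gT) (p : {mpoly F[n]}) : {mpoly F[n]} :=
  p \mPo [tuple \sum_(j < n) rG g i j *: 'X_j | i < n].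

Definition invariant (p : {mpoly F[n]}) : Prop :=
  forall g, g \in G -> sym_act g p = p.

End OneModule.

Inductive subalg_gen (A : algType F) (S : A -> Prop) : A -> Prop :=
| subalg_gen_in x : S x -> subalg_gen S x
| subalg_gen_scalar (c : F) : subalg_gen S c%:A
| subalg_gen_add x y : subalg_gen S x -> subalg_gen S y -> subalg_gen S (x + y)
| subalg_gen_mul x y : subalg_gen S x -> subalg_gen S y -> subalg_gen S (x * y).

Definition generated_upto n (rG : mx_representation F G n) (d : nat) : Prop :=
  forall p, invariant rG p ->
  subalg_gen
    (fun q => invariant rG q /\ exists2 k, (k <= d)%N & q \is k.-homog) p.

Definition is_beta n (rG : mx_representation F G n) (d : nat) : Prop :=
  generated_upto rG d /\ forall d', generated_upto rG d' -> (d <= d')%N.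

(* The supremum is finite and equal to m. The first clause also asserts that
   beta is finite for every module, so that no module escapes the bound. *)
Definition is_noether_number (m : nat) : Prop :=
  (forall n (rG : mx_representation F G n),
      exists2 d, is_beta rG d & (d <= m)%N)
  /\ (forall m', (forall n (rG : mx_representation F G n) d,
                     is_beta rG d -> (d <= m')%N) -> (m <= m')%N).

End Invariants.

Local Open Scope group_scope.

Definition is_V4_sdprod_C4 (gT : finGroupType) (G : {group gT}) : Prop :=
  exists a b c : gT,
    [/\ [/\ #[a] = 2%N, #[b] = 2%N & #[c] = 4%N],
        <[a]> \x <[b]> ><| <[c]> = G,
        a ^ c = b & b ^ c = a].

(* Main.v *)
Require Import Defs.
From mathcomp Require Import all_boot all_order all_algebra.
From mathcomp Require Import all_fingroup all_solvable all_character.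
From mathcomp Require Import ring zify.
From Stdlib Require Import Classical.

(** Let [a], [b] generate the Klein four-group and let [c] be the element of
    order 4 that exchanges them. The elements [a], [b], [c^2] generate an
    abelian normal subgroup [A] of index 2, an elementary group of order 8.

    Upper bound. Since 2 is invertible, every linear form is a sum of weight
    vectors of [A], whose weights lie in [F_2^3], so [S(V)] is spanned by
    products of weight vectors. Such a product is [A]-invariant when its
    weights sum to zero, and [S(V)^G] is spanned by the transfers
    [q + c.q] of the [A]-invariant products [q] (lemma [noether_bound]). It is
    enough to express the transfer of a product of degree at least 7 by
    invariants of smaller degree ([transfer_form_generated]).
    - If [q = xyz] for three [A]-invariant factors of positive degree, twice
      its transfer is a polynomial in the transfers of [x], [y], [z], [xy],
      [yz] and [x (c.z)] ([transfer_mul3]).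
    - Four elements of [F_2^3] are linearly dependent, so a zero-sum sequence
      of length at least 5 splits into two ([zero_sum_split]); hence a
      zero-sum sequence of length at least 7 that contains 0 or a repetition
      splits into three ([three_zero_sums]).
    - The remaining products have each of the seven nonzero weights exactly
      once. Let [l] be the product of the factors of weights (0,0,1), (1,0,0),
      (1,0,1), a line of the Fano plane that [c] does not preserve, and let
      [r] be the product of the others. As
      [transfer (l r) = transfer l * transfer r - transfer ((c.l) r)]
      ([transfer_mul2]) and the weights of [(c.l) r] have a repetition, the
      previous case applies.

    Lower bound. Let [G] act on [F[x1, x2, y1, y2]] by signed permutations of
    the variables: [a] negates [x1] and [y1], [b] negates [x2] and [y2], and
    [c] acts as [x1 -> x2 -> x1] and [y1 -> y2 -> - y1]. The degree 6 invariant
    [x1 x2 y1 y2 (x1^2 - x2^2)] is not a polynomial in invariants of lower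
    degree: the invariants without the monomial [x1^3 x2 y1 y2] form
    a subalgebra ([mcoeff_top_mul]), because the only factorization of this
    monomial into nonconstant [A]-invariant monomials is
    [x1^2 * (x1 x2 y1 y2)], and [c] changes the sign of [x1 x2 y1 y2]. *)

Set Implicit Arguments.
Unset Strict Implicit.
Unset Printing Implicit Defensive.
Import GRing.Theory.
Local Open Scope ring_scope.

(** * Zero-sum sequences over an elementary abelian group of order 8 *)

(** A weight is a character of [A], recorded by the exponents of the signs by
    which [a], [b] and [c^2] act; the group law is the componentwise [addb]. *)
Notation weight := (bool * bool * bool)%type.

Definition weights : seq weight :=
  [seq (p, z) | p <- [seq (x, y) | x <- [:: true; false], y <- [:: true; false]],
                z <- [:: true; false]].

Lemma mem_weights w : w \in weights.
Proof. by case: w => [[[] []] []]. Qed.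

Lemma weight_addxx (w : weight) : w + w = 0.
Proof. by case: w => [[[] []] []]. Qed.

Lemma perm_mask_negb (T : eqType) (m : bitseq) (s : seq T) :
  size m = size s -> perm_eq (mask m s ++ mask (map negb m) s) s.
Proof.
elim: s m => [|x s IHs] [|[] m] //= [/IHs sm]; first by rewrite perm_cons.
by rewrite perm_catC /= perm_cons perm_catC.
Qed.

(** The zero-sum subsequence exists because four vectors of a space of dimension
    3 over the field with two elements are linearly dependent. *)
Lemma four_weights_dependent (w1 w2 w3 w4 : weight) :
  exists2 m : bitseq, size m = 4 /\ has id m
    & \sum_(w <- mask m [:: w1; w2; w3; w4]) w = 0.
Proof.
pose bits := [:: true; false].
pose masks := [seq [:: p.1.1; p.1.2; p.2.1; p.2.2] |
   p <- [seq (x, y) | x <- [seq (x, y) | x <- bits, y <- bits],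
                      y <- [seq (x, y) | x <- bits, y <- bits]]].
have dec : all (fun w1 => all (fun w2 => all (fun w3 => all (fun w4 =>
    has (fun m => has id m &&
       (foldr +%R 0 (mask m [:: w1; w2; w3; w4]) == 0 :> weight)) masks)
  weights) weights) weights) weights by vm_compute.
have /hasP[m m_in /andP[m_nz /eqP sum0]] := allP (allP (allP (allP dec
  _ (mem_weights w1)) _ (mem_weights w2)) _ (mem_weights w3)) _ (mem_weights w4).
exists m; last by rewrite -foldrE.
by split; [case/mapP: m_in => p _ -> | exact: m_nz].
Qed.

Section ZeroSum.

Variables (T : eqType) (f : T -> weight).
Implicit Types s : seq T.

Definition zero_sum s := \sum_(x <- s) f x == 0.

Lemma zero_sum_cat s1 s2 : zero_sum s1 -> zero_sum (s1 ++ s2) = zero_sum s2.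
Proof. by rewrite /zero_sum big_cat /= => /eqP ->; rewrite add0r. Qed.

Lemma perm_zero_sum s1 s2 : perm_eq s1 s2 -> zero_sum s1 = zero_sum s2.
Proof. by move=> s12; rewrite /zero_sum (perm_big _ s12). Qed.

(** The first four terms contain a nonempty zero-sum subsequence, and at least
    one term is left over. *)
Lemma zero_sum_split s : (4 < size s)%N -> zero_sum s ->
  exists s1 s2, [/\ perm_eq s (s1 ++ s2), s1 != [::], s2 != [::],
                    zero_sum s1 & zero_sum s2].
Proof.
case: s => [|x1 [|x2 [|x3 [|x4 r]]]] //= r_gt0 zs.
set q := [:: x1; x2; x3; x4].
have [m [sz_m m_nz] m0] := four_weights_dependent (f x1) (f x2) (f x3) (f x4).
have zs_m : zero_sum (mask m q) by rewrite /zero_sum -(big_map f xpredT id) map_mask m0.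
have p_s : perm_eq (q ++ r) (mask m q ++ (mask (map negb m) q ++ r)).
  by rewrite catA perm_cat2r perm_sym perm_mask_negb.
exists (mask m q), (mask (map negb m) q ++ r); split=> //.
- by rewrite -size_eq0 size_mask // -lt0n -has_count.
- by case: (r) r_gt0 => // y r' _; case: (mask _ _).
- by rewrite -(zero_sum_cat _ zs_m) -(perm_zero_sum p_s).
Qed.

(** Either a zero weight or a pair of equal weights provides the subsequence,
    since every weight is its own opposite. *)
Lemma short_zero_sum s : ~~ uniq (0 :: map f s) ->
  exists s1 s2, [/\ perm_eq s (s1 ++ s2), s1 != [::], (size s1 <= 2)%N & zero_sum s1].
Proof.
elim: s => [|x s IHs] //=; rewrite inE !(negb_and, negbK).
have IH : ~~ uniq (0 :: map f s) ->
  exists s1 s2, [/\ perm_eq (x :: s) (s1 ++ s2), s1 != [::], (size s1 <= 2)%N & zero_sum s1].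
  case/IHs=> s1 [s2 [p12 s1_nz sz1 zs1]]; exists s1, (x :: s2); split=> //.
  by rewrite perm_sym -[x :: s2]/([:: x] ++ s2) perm_catCA perm_sym /= perm_cons.
case/orP=> [/orP[/eqP fx0|s0]|/orP[fx_s|s_nu]].
- by exists [:: x], s; split=> //; rewrite /zero_sum big_seq1 -fx0.
- by apply: IH; rewrite /= s0.
- have [y ys fxy] := mapP fx_s.
  exists [:: x; y], (rem y s); split=> //.
    by rewrite perm_cons perm_to_rem.
  by rewrite /zero_sum !big_cons big_nil addr0 fxy weight_addxx.
- by apply: IH; rewrite /= negb_and s_nu orbT.
Qed.

(** Removing the short zero-sum subsequence leaves at least five terms. *)
Lemma three_zero_sums s : (6 < size s)%N -> zero_sum s -> ~~ uniq (0 :: map f s) ->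
  exists s1 s2 s3, [/\ perm_eq s (s1 ++ s2 ++ s3),
    [/\ s1 != [::], s2 != [::] & s3 != [::]]
    & [/\ zero_sum s1, zero_sum s2 & zero_sum s3]].
Proof.
move=> sz zs /short_zero_sum[s1 [s2 [p12 s1_nz sz1 zs1]]].
have [||s3 [s4 [p34 s3_nz s4_nz zs3 zs4]]] := @zero_sum_split s2.
- have := sz; rewrite (perm_size p12) size_cat => lt6.
  by rewrite -(ltn_add2l (size s1)); apply: leq_ltn_trans lt6; rewrite (leq_add2r 4 _ 2).
- by rewrite -(zero_sum_cat _ zs1) -(perm_zero_sum p12).
by exists s1, s3, s4; split=> //; rewrite (perm_trans p12) // perm_cat2l.
Qed.

(** There are only seven nonzero weights, so an injective sequence of seven of
    them is exhaustive. *)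
Lemma all_weights_occur s : (6 < size s)%N -> uniq (0 :: map f s) ->
  forall w, w != 0 -> w \in map f s.
Proof.
move=> sz us w w_nz.
have [||_ sub] := uniq_min_size us (s2 := weights).
- by move=> v _; exact: mem_weights.
- by rewrite /= size_map.
by have := mem_weights w; rewrite -sub inE (negPf w_nz).
Qed.

End ZeroSum.

(** * The action on the symmetric algebra *)

Section SymmetricAlgebraAction.

Variables (F : fieldType) (gT : finGroupType) (G : {group gT}).
Variables (n : nat) (rG : mx_representation F G n).
Implicit Types (v : 'rV[F]_n) (p q : {mpoly F[n]}) (g h : gT).

Definition lin_form v : {mpoly F[n]} := \sum_(j < n) v 0 j *: 'X_j.

Lemma lin_formD u v : lin_form (u + v) = lin_form u + lin_form v.
Proof. by rewrite -big_split; apply: eq_bigr => j _; rewrite mxE scalerDl. Qed.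

Lemma lin_formZ k v : lin_form (k *: v) = k *: lin_form v.
Proof. by rewrite scaler_sumr; apply: eq_bigr => j _; rewrite mxE scalerA. Qed.

Lemma lin_form_delta i : lin_form (delta_mx 0 i) = 'X_i.
Proof.
rewrite /lin_form (bigD1 i) //= mxE !eqxx scale1r big1 ?addr0 // => j.
by rewrite mxE eqxx /= => /negPf ->; rewrite scale0r.
Qed.

Lemma lin_form_homog v : lin_form v \is 1.-homog.
Proof. by apply: rpred_sum => j _; rewrite rpredZ // dhomogX /= mdeg1. Qed.

Lemma sym_actD g p q : sym_act rG g (p + q) = sym_act rG g p + sym_act rG g q.
Proof. exact: comp_mpolyD. Qed.

Lemma sym_actZ g k p : sym_act rG g (k *: p) = k *: sym_act rG g p.
Proof. exact: comp_mpolyZ. Qed.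

Lemma sym_actM g p q : sym_act rG g (p * q) = sym_act rG g p * sym_act rG g q.
Proof. exact: rmorphM. Qed.

Lemma sym_act1p g : sym_act rG g 1 = 1.
Proof. exact: comp_mpoly1. Qed.

Lemma sym_actXn g k p : sym_act rG g (p ^+ k) = sym_act rG g p ^+ k.
Proof. exact: rmorphXn. Qed.

Lemma sym_act_sum g I r (P : pred I) (E : I -> {mpoly F[n]}) :
  sym_act rG g (\sum_(i <- r | P i) E i) = \sum_(i <- r | P i) sym_act rG g (E i).
Proof. exact: raddf_sum. Qed.

Lemma sym_act_prod g I r (P : pred I) (E : I -> {mpoly F[n]}) :
  sym_act rG g (\prod_(i <- r | P i) E i) = \prod_(i <- r | P i) sym_act rG g (E i).
Proof. exact: rmorph_prod. Qed.

Lemma sym_act_var g i : sym_act rG g 'X_i = \sum_(j < n) rG g i j *: 'X_j.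
Proof. by rewrite /sym_act comp_mpolyXU -tnth_nth tnth_mktuple. Qed.

Lemma sym_act_lin_form g v : sym_act rG g (lin_form v) = lin_form (v *m rG g).
Proof.
rewrite sym_act_sum.
under eq_bigr => i _ do rewrite sym_actZ sym_act_var scaler_sumr.
rewrite exchange_big; apply: eq_bigr => j _; rewrite mxE scaler_suml.
by apply: eq_bigr => i _; rewrite scalerA.
Qed.

Lemma lin_forms_generate (K : {mpoly F[n]} -> Prop) :
    K 1 -> (forall k p, K p -> K (k *: p)) ->
    (forall p q, K p -> K q -> K (p + q)) ->
    (forall p q, K p -> K q -> K (p * q)) ->
    (forall v, K (lin_form v)) ->
  forall p, K p.
Proof.
move=> K1 KZ KD KM Kl p; have K0: K 0 by rewrite -(scale0r 1); apply: KZ.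
rewrite (mpolyE p); apply: big_ind => // m _; apply: KZ.
rewrite mpolyXE_id; apply: big_ind => // i _.
elim: (m i) => [|k IHk]; rewrite ?expr0 // exprS; apply: KM => //.
by rewrite -lin_form_delta; exact: Kl.
Qed.

Lemma sym_actMg g h p : g \in G -> h \in G ->
  sym_act rG (g * h)%g p = sym_act rG h (sym_act rG g p).
Proof.
move=> Gg Gh; elim/lin_forms_generate: p => [|k p IHp|p q IHp IHq|p q IHp IHq|v].
- by rewrite !sym_act1p.
- by rewrite !sym_actZ IHp.
- by rewrite !sym_actD IHp IHq.
- by rewrite !sym_actM IHp IHq.
- by rewrite !sym_act_lin_form repr_mxM // mulmxA.
Qed.

Lemma sym_act1g p : sym_act rG 1%g p = p.
Proof.
elim/lin_forms_generate: p => [|k p IHp|p q IHp IHq|p q IHp IHq|v].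
- by rewrite !sym_act1p.
- by rewrite !sym_actZ IHp.
- by rewrite !sym_actD IHp IHq.
- by rewrite !sym_actM IHp IHq.
- by rewrite !sym_act_lin_form repr_mx1 mulmx1.
Qed.

Lemma sym_actX_fix g k p : g \in G -> sym_act rG g p = p ->
  sym_act rG (g ^+ k)%g p = p.
Proof.
move=> Gg gp; elim: k => [|k IHk]; first by rewrite sym_act1g.
by rewrite expgS sym_actMg ?groupX // gp.
Qed.

Lemma invariantD p q : Defs.invariant rG p -> Defs.invariant rG q -> Defs.invariant rG (p + q).
Proof. by move=> Ip Iq g Gg; rewrite sym_actD Ip ?Iq. Qed.

Lemma invariantM p q : Defs.invariant rG p -> Defs.invariant rG q -> Defs.invariant rG (p * q).
Proof. by move=> Ip Iq g Gg; rewrite sym_actM Ip ?Iq. Qed.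

Lemma invariantC k : Defs.invariant rG k%:A.
Proof. by move=> g Gg; rewrite sym_actZ sym_act1p. Qed.

Lemma generated_upto_monotone d d' : (d <= d')%N ->
  generated_upto rG d -> generated_upto rG d'.
Proof.
move=> le_dd' gen p /gen; elim=> [q [Iq [k le_kd hq]]|k|q r _ Sq _ Sr|q r _ Sq _ Sr].
- by apply: subalg_gen_in; split=> //; exists k => //; apply: leq_trans le_dd'.
- exact: subalg_gen_scalar.
- exact: subalg_gen_add.
- exact: subalg_gen_mul.
Qed.

(** The valid degree bounds form an up-closed set of natural numbers, so its
    minimum is found by descending from [d]; each step is a classical case
    distinction. *)
Lemma beta_exists d : generated_upto rG d -> exists2 d', is_beta rG d' & (d' <= d)%N.
Proof.
elim: d => [|d IHd] gen; first by exists 0%N.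
have [/IHd[d' bd' le_d'd]|ngen] := classic (generated_upto rG d).
  by exists d' => //; apply: leqW.
exists d.+1 => //; split=> // d' gen'; rewrite ltnNge; apply/negP=> le_d'd.
exact/ngen/(generated_upto_monotone le_d'd).
Qed.

End SymmetricAlgebraAction.


(** * Words in the generators of the group *)

Section V4C4.

Variables (gT : finGroupType) (G : {group gT}).
Local Open Scope group_scope.

(** The presentation of the group together with the normal form of its
    elements; [gen_free] makes the normal form unique. *)
Record V4C4_gens (a b c : gT) : Prop := V4C4Gens {
  gen_a : a \in G; gen_b : b \in G; gen_c : c \in G;
  gen_aa : a * a = 1; gen_bb : b * b = 1; gen_c4 : c ^+ 4 = 1;
  gen_ab : a * b = b * a; gen_ac : a * c = c * b; gen_bc : b * c = c * a;
  gen_words : forall g, g \in G ->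
    exists (i j : bool) (k : 'I_4), g = a ^+ i * b ^+ j * c ^+ k;
  gen_free : forall i j k i' j' k',
    a ^+ i * b ^+ j * c ^+ k = a ^+ i' * b ^+ j' * c ^+ k' ->
    [/\ i = i' %[mod 2], j = j' %[mod 2] & k = k' %[mod 4]] }.

Lemma V4C4_gensP : is_V4_sdprod_C4 G -> exists a b c, V4C4_gens a b c.
Proof.
case=> a [b [c [[oa ob oc] defG ac bc]]]; exists a, b, c.
have [[H C defH defC] mulHC _ _] := sdprodP defG; rewrite defH defC in defG mulHC.
have [_ mulab cab _] := dprodP defH.
have Ha : a \in H by rewrite -cycle_subG -mulab mulG_subl.
have Hb : b \in H by rewrite -cycle_subG -mulab mulG_subr.
have Cc : c \in C by rewrite -defC cycle_id.
have [/subsetP sHG /subsetP sCG] : H \subset G /\ C \subset G.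
  by rewrite -mulHC mulG_subl mulG_subr.
have ab : a * b = b * a.
  by symmetry; apply: (centsP cab); rewrite cycle_id.
split.
- exact: sHG.
- exact: sHG.
- exact: sCG.
- by rewrite -[a * a]/(a ^+ 2) -oa expg_order.
- by rewrite -[b * b]/(b ^+ 2) -ob expg_order.
- by rewrite -oc expg_order.
- exact: ab.
- by rewrite conjgC ac.
- by rewrite conjgC bc.
- move=> g; rewrite -mulHC -defC -mulab.
  case/mulsgP=> h d /mulsgP[x y /cyclePmin[i i2 ->] /cyclePmin[j j2 ->] ->].
  case/cyclePmin=> k k4 -> ->; rewrite oa in i2; rewrite ob in j2; rewrite oc in k4.
  exists (i == 1%N), (j == 1%N), (Ordinal k4).
  by case: i i2 => [|[]] // _; case: j j2 => [|[]].
move=> i j k i' j' k' eqg.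
have Hab x y : a ^+ x * b ^+ y \in H by rewrite groupM ?groupX.
have Cck x : c ^+ x \in C by rewrite groupX.
have [|h [d [_ _ _ uniq_hd]]] := mem_sdprod defG (x := a ^+ i * b ^+ j * c ^+ k).
  by apply: groupM; [exact: sHG | exact: sCG].
have [h_ij d_k] := uniq_hd _ _ (Hab i j) (Cck k) erefl.
have [h_ij' d_k'] := uniq_hd _ _ (Hab i' j') (Cck k') eqg.
have [x [y [_ _ _ uniq_xy]]] := mem_dprod defH (Hab i j).
have [x_i y_j] := uniq_xy _ _ (mem_cycle a i) (mem_cycle b j) erefl.
have [|x_i' y_j'] := uniq_xy _ _ (mem_cycle a i') (mem_cycle b j').
  by rewrite h_ij.
split; apply/eqP.
- by rewrite -oa -eq_expg_mod_order x_i x_i'.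
- by rewrite -ob -eq_expg_mod_order y_j y_j'.
- by rewrite -oc -eq_expg_mod_order d_k d_k'.
Qed.

End V4C4.

(** * The upper bound *)

(** Here [x'] stands for the image of [x] under an involution. *)
Lemma transfer_identity (R : comPzRingType) (x y z x' y' z' : R) :
  (x * y * z + x' * y' * z') *+ 2 = (x * y + x' * y') * (z + z')
    - (x * z' + x' * z) * (y + y') + (x + x') * (y * z + y' * z').
Proof. ring. Qed.

Local Opaque sym_act.

Section UpperBound.

Variables (F : fieldType) (gT : finGroupType) (G : {group gT}) (a b c : gT).
Variables (n : nat) (rG : mx_representation F G n).
Hypotheses (charF : 2 \notin [pchar F]) (gensG : V4C4_gens G a b c).

Let Ga := gen_a gensG.
Let Gb := gen_b gensG.
Let Gc := gen_c gensG.
Let Gcc : (c * c)%g \in G. Proof. exact: groupM. Qed.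

Local Notation vec := ('rV[F]_n).
Local Notation item := (weight * vec)%type.
Local Notation act := (sym_act rG).
Implicit Types (x : item) (s : seq item) (p q : {mpoly F[n]}) (e : bool).

Let two_neq0 : 2%:R != 0 :> F.
Proof. by move: charF; rewrite inE. Qed.

Lemma invariant_gens p : act a p = p -> act b p = p -> act c p = p ->
  Defs.invariant rG p.
Proof.
move=> ap bp cp g /(gen_words gensG)[i [j [k ->]]].
have [Gai Gbj Gck] : [/\ (a ^+ i \in G)%g, (b ^+ j \in G)%g & (c ^+ k \in G)%g].
  by split; apply: groupX.
rewrite (sym_actMg rG p (groupM Gai Gbj) Gck) (sym_actMg rG p Gai Gbj).
by rewrite (sym_actX_fix _ Ga ap) (sym_actX_fix _ Gb bp) (sym_actX_fix _ Gc cp).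
Qed.

Definition weight_vector x : bool :=
  [&& x.2 *m rG a == (-1) ^+ x.1.1.1 *: x.2,
      x.2 *m rG b == (-1) ^+ x.1.1.2 *: x.2
    & x.2 *m rG (c * c)%g == (-1) ^+ x.1.2 *: x.2].

(** The monomials of the argument: products of weight vectors, which need not
    come from a common basis of the module. *)
Definition form s : {mpoly F[n]} := \prod_(x <- s) lin_form x.2.

Lemma form_cat s1 s2 : form (s1 ++ s2) = form s1 * form s2.
Proof. exact: big_cat. Qed.

Lemma perm_form s1 s2 : perm_eq s1 s2 -> form s1 = form s2.
Proof. exact: perm_big. Qed.

Lemma form_homog s : form s \is (size s).-homog.
Proof.
elim: s => [|x s IHs]; first by rewrite /form big_nil dhomog1.
by rewrite /form big_cons; apply: (dhomogM (lin_form_homog _) IHs).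
Qed.

Lemma act_form_sign g (chi : weight -> bool) s :
    chi 0 = false -> {morph chi : u v / u + v} ->
    {in s, forall x, x.2 *m rG g = (-1) ^+ chi x.1 *: x.2} ->
  act g (form s) = (-1) ^+ chi (\sum_(x <- s) x.1) *: form s.
Proof.
move=> chi0 chiD; elim: s => [|x s IHs] sgn.
  by rewrite /form !big_nil sym_act1p chi0 scale1r.
rewrite /form !big_cons sym_actM sym_act_lin_form sgn ?mem_head // chiD.
rewrite lin_formZ [act g _]IHs => [|y sy]; last by rewrite sgn ?inE ?sy ?orbT.
by rewrite -scalerAl -scalerAr scalerA signr_addb.
Qed.

Lemma act_form s : all weight_vector s -> let w := \sum_(x <- s) x.1 in
  [/\ act a (form s) = (-1) ^+ w.1.1 *: form s,
      act b (form s) = (-1) ^+ w.1.2 *: form s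
    & act (c * c)%g (form s) = (-1) ^+ w.2 *: form s].
Proof.
move=> /allP ws w; split.
- apply: (@act_form_sign _ (fun u => u.1.1)) => // x /ws /and3P[/eqP xa _ _].
  exact: xa.
- apply: (@act_form_sign _ (fun u => u.1.2)) => // x /ws /and3P[_ /eqP xb _].
  exact: xb.
- apply: (@act_form_sign _ (fun u => u.2)) => // x /ws /and3P[_ _ /eqP xcc].
  exact: xcc.
Qed.

(** Conjugation by [c] exchanges [a] and [b] and fixes [c^2], hence [c] carries
    a weight vector to one whose first two coordinates are exchanged. *)
Definition twist x : item := ((x.1.1.2, x.1.1.1, x.1.2), x.2 *m rG c).

Lemma twist_weight_vector x : weight_vector x -> weight_vector (twist x).
Proof.
case/and3P=> /eqP xa /eqP xb /eqP xcc; apply/and3P; split=> /=; apply/eqP.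
- rewrite -mulmxA -repr_mxM // -(gen_bc gensG) repr_mxM // mulmxA xb.
  by rewrite -scalemxAl.
- rewrite -mulmxA -repr_mxM // -(gen_ac gensG) repr_mxM // mulmxA xa.
  by rewrite -scalemxAl.
- by rewrite -mulmxA -repr_mxM // mulgA repr_mxM // mulmxA xcc -scalemxAl.
Qed.

Lemma all_twist s : all weight_vector s -> all weight_vector (map twist s).
Proof.
by move/allP=> ws; apply/allP=> _ /mapP[x /ws wx ->]; apply: twist_weight_vector.
Qed.

Lemma zero_sum_twist s : zero_sum fst s -> zero_sum fst (map twist s).
Proof.
rewrite /zero_sum big_map; set u := \sum_(x <- s) x.1 => /eqP u0.
have -> : \sum_(x <- s) (twist x).1 = (u.1.2, u.1.1, u.2).
  by rewrite /u; elim: s {u u0} => [|x s IHs]; rewrite ?big_nil // !big_cons IHs.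
by rewrite u0.
Qed.

Lemma act_c_form s : act c (form s) = form (map twist s).
Proof.
rewrite sym_act_prod /form big_map.
by apply: eq_bigr => x _; rewrite sym_act_lin_form.
Qed.

(** On [A]-invariants, [c] acts as an involution although it has order 4. *)
Lemma act_cK s : all weight_vector s -> zero_sum fst s ->
  act c (act c (form s)) = form s.
Proof.
move=> /act_form[_ _ cc] /eqP s0; move: cc.
by rewrite -sym_actMg // s0 scale1r.
Qed.

Definition transfer q : {mpoly F[n]} := q + act c q.

Lemma transfer_invariant s : all weight_vector s -> zero_sum fst s ->
  Defs.invariant rG (transfer (form s)).
Proof.
move=> ws s0; have wts := all_twist ws; have ts0 := zero_sum_twist s0.
have fix_ab r : all weight_vector r -> zero_sum fst r ->
    act a (form r) = form r /\ act b (form r) = form r.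
  by move=> /act_form[-> -> _] /eqP ->; rewrite !scale1r.
have [sa sb] := fix_ab s ws s0; have [tsa tsb] := fix_ab _ wts ts0.
apply: invariant_gens; rewrite /transfer sym_actD.
- by rewrite act_c_form tsa sa.
- by rewrite act_c_form tsb sb.
- by rewrite (act_cK ws s0) addrC.
Qed.

Local Notation Sub := (subalg_gen (fun q =>
  Defs.invariant rG q /\ exists2 k, (k <= 6)%N & q \is k.-homog)).

Lemma Sub_scale k q : Sub q -> Sub (k *: q).
Proof.
by move=> Sq; rewrite -mulr_algl; apply: subalg_gen_mul => //; apply: subalg_gen_scalar.
Qed.

Lemma Sub_sub p q : Sub p -> Sub q -> Sub (p - q).
Proof.
by move=> Sp Sq; rewrite -scaleN1r; apply: subalg_gen_add => //; apply: Sub_scale.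
Qed.

(** Modulo products of transfers, applying [c] to [z], to [y] or to [y * z]
    changes the sign of the transfer of [x * y * z]. Doing the first two in
    succession amounts to the third, so this transfer equals its
    opposite modulo products. *)
Lemma transfer_mul3 (x y z : {mpoly F[n]}) : act c (act c z) = z ->
  transfer (x * y * z) *+ 2 = transfer (x * y) * transfer z
    - transfer (x * act c z) * transfer y + transfer x * transfer (y * z).
Proof.
by move=> zK; rewrite /transfer !sym_actM zK; apply: transfer_identity.
Qed.

(** Modulo products of transfers, replacing the factor [x] by its image under
    [c] changes the sign of the transfer. *)
Lemma transfer_mul2 (x y : {mpoly F[n]}) : act c (act c x) = x ->
  transfer (x * y) = transfer x * transfer y - transfer (act c x * y).
Proof. by move=> xK; rewrite /transfer !sym_actM xK; ring. Qed.

(** By induction on the degree. Three-factor products reduce to smaller degree;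
    a product in which every nonzero weight occurs once is first turned into a
    three-factor one by applying [c] to the factors on one line of the Fano
    plane. *)
Lemma transfer_form_generated s : all weight_vector s -> zero_sum fst s ->
  Sub (transfer (form s)).
Proof.
have [k] := ubnP (size s); elim: k s => // k IHk s; rewrite ltnS => sz_s ws s0.
have [le_s6|gt_s6] := leqP (size s) 6.
  apply: subalg_gen_in; split; first exact: transfer_invariant.
  exists (size s) => //; rewrite rpredD ?form_homog // act_c_form.
  by rewrite -(size_map twist) form_homog.
have Sub3 r : size r = size s -> all weight_vector r -> zero_sum fst r ->
    ~~ uniq (0 :: map fst r) -> Sub (transfer (form r)).
  move=> sz_r wr r0 nur.
  have [|r1 [r2 [r3 [p_r [nz1 nz2 nz3] [z1 z2 z3]]]]] := three_zero_sums _ r0 nur.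
    by rewrite sz_r.
  have := wr; rewrite (perm_all _ p_r) !all_cat => /and3P[w1 w2 w3].
  have sz : (size r1 + (size r2 + size r3) <= k)%N.
    by rewrite -!size_cat -(perm_size p_r) sz_r.
  move: nz1 nz2 nz3; rewrite -!size_eq0 -!lt0n => nz1 nz2 nz3.
  have [wt3 zt3] := (all_twist w3, zero_sum_twist z3).
  have IH1 t : (size t < k)%N -> all weight_vector t -> zero_sum fst t ->
    Sub (transfer (form t)) by exact: IHk.
  have IH2 t u : (size t + size u < k)%N -> all weight_vector t ->
      all weight_vector u -> zero_sum fst t -> zero_sum fst u ->
      Sub (transfer (form t * form u)).
    move=> sz_tu wt wu t0 u0; rewrite -form_cat; apply: IH1.
    - by rewrite size_cat.
    - by rewrite all_cat wt.
    - by rewrite zero_sum_cat.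
  rewrite (perm_form p_r) !form_cat mulrA.
  have -> q : transfer q = 2%:R^-1 *: (transfer q *+ 2).
    by rewrite -scaler_nat scalerA mulVf ?scale1r.
  apply: Sub_scale; rewrite transfer_mul3 ?act_cK // act_c_form.
  have [sz1 sz2 sz3] : [/\ (size r1 < k)%N, (size r2 < k)%N & (size r3 < k)%N].
    by clear -sz nz1 nz2 nz3; split; lia.
  have [sz12 sz13 sz23] : [/\ (size r1 + size r2 < k)%N,
      (size r1 + size (map twist r3) < k)%N & (size r2 + size r3 < k)%N].
    have -> : size (map twist r3) = size r3 by exact: size_map.
    by clear -sz nz1 nz2 nz3; split; lia.
  apply: subalg_gen_add; first apply: Sub_sub; apply: subalg_gen_mul.
  - exact: IH2 sz12 w1 w2 z1 z2.
  - exact: IH1 sz3 w3 z3.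
  - exact: IH2 sz13 w1 wt3 z1 zt3.
  - exact: IH1 sz2 w2 z2.
  - exact: IH1 sz1 w1 z1.
  - exact: IH2 sz23 w2 w3 z2 z3.
have [us|nus] := boolP (uniq (0 :: map fst s)); last exact: Sub3.
have all_w := all_weights_occur gt_s6 us.
(* The exchange of the first two coordinates sends this line to another one,
   which contains the weight (0,1,0) that is still present off the line. *)
pose line : seq weight :=
  [:: (false, false, true); (true, false, false); (true, false, true)].
pose on_line := [pred x : item | x.1 \in line].
pose l := filter on_line s; pose q := filter (predC on_line) s.
have p_s : perm_eq s (l ++ q) by rewrite perm_sym perm_filterC.
have p_l : perm_eq (map fst l) line.
  have us' : uniq (map fst s) by case/andP: us.
  apply: uniq_perm => // [|w].
    by apply: subseq_uniq us'; apply/map_subseq/filter_subseq.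
  apply/mapP/idP=> [[x]|w_l]; first by rewrite mem_filter => /andP[xl _] ->.
  have /all_w/mapP[x sx def_w] : w != 0.
    by move: w_l; rewrite !inE; case/or3P=> /eqP ->.
  by exists x => //; rewrite mem_filter /= -def_w w_l.
have l0 : zero_sum fst l.
  by rewrite /zero_sum -(big_map fst xpredT id) (perm_big _ p_l) !big_cons big_nil.
have q0 : zero_sum fst q by rewrite -(zero_sum_cat _ l0) -(perm_zero_sum _ p_s).
have sz_l : size l = 3 by rewrite -(size_map fst) (perm_size p_l).
have sz_q : (size l + size q = size s)%N by rewrite (perm_size p_s) size_cat.
have := ws; rewrite (perm_all _ p_s) all_cat => /andP[wl wq].
rewrite (perm_form p_s) form_cat transfer_mul2 ?act_cK // act_c_form -form_cat.
apply: Sub_sub.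
  have [lt_lk lt_qk] : (size l < k)%N /\ (size q < k)%N.
    by clear -sz_s gt_s6 sz_l sz_q; lia.
  by apply: subalg_gen_mul; apply: IHk.
apply: Sub3.
- by rewrite size_cat size_map.
- by rewrite all_cat all_twist.
- by rewrite zero_sum_cat // zero_sum_twist.
rewrite /= map_cat cat_uniq; apply/nandP; right; rewrite negb_and negb_and.
have /all_w/mapP[x sx def_x] : (false, true, false) != 0 :> weight by [].
have xq : x \in q by rewrite mem_filter /= -def_x sx.
have /mapP[y ly def_y] : (true, false, false) \in map fst l by rewrite (perm_mem p_l).
apply/orP; right; apply/orP; left; rewrite negbK; apply/hasP; exists x.1; first exact: map_f.
by rewrite -def_x; apply/mapP; exists (twist y); [apply: map_f | rewrite /= -def_y].
Qed.

(** Twice the projection of [v] on the eigenspace of the involution [g] for the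
    eigenvalue [(-1) ^+ e]. *)
Definition eigen_part g e (v : vec) : vec := v + (-1) ^+ e *: (v *m rG g).

Lemma eigen_part_sum g v :
  v = 2%:R^-1 *: (eigen_part g false v + eigen_part g true v).
Proof.
rewrite /eigen_part scale1r scaleN1r addrACA subrr addr0 -mulr2n -scaler_nat.
by rewrite scalerA mulVf ?scale1r.
Qed.

Lemma eigen_part_eigen g e v : g \in G -> (g * g = 1)%g ->
  eigen_part g e v *m rG g = (-1) ^+ e *: eigen_part g e v.
Proof.
move=> Gg gg; rewrite mulmxDl -scalemxAl -mulmxA -repr_mxM // gg repr_mx1 mulmx1.
by rewrite scalerDr scalerA -signr_addb addbb scale1r addrC.
Qed.

Lemma eigen_part_stable g h e k v : g \in G -> h \in G -> (g * h = h * g)%g ->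
  v *m rG h = k *: v -> eigen_part g e v *m rG h = k *: eigen_part g e v.
Proof.
move=> Gg Gh gh vh; rewrite mulmxDl -scalemxAl -mulmxA -repr_mxM // gh repr_mxM //.
by rewrite mulmxA vh -scalemxAl scalerDr scalerA mulrC -scalerA.
Qed.

Lemma weight_vectors_span (L : vec -> Prop) :
    (forall k v, L v -> L (k *: v)) -> (forall u v, L u -> L v -> L (u + v)) ->
    (forall x, weight_vector x -> L x.2) ->
  forall v, L v.
Proof.
move=> LZ LD Lw v.
have split_L g u : (forall e, L (eigen_part g e u)) -> L u.
  by move=> Lg; rewrite (eigen_part_sum g u); apply/LZ/LD.
have [[aa bb] [ab ac bc]] := ((gen_aa gensG, gen_bb gensG),
  And3 (gen_ab gensG) (gen_ac gensG) (gen_bc gensG)).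
have cca : (c * c * a = a * (c * c))%g by rewrite -mulgA -bc !mulgA ac.
have ccb : (c * c * b = b * (c * c))%g by rewrite -mulgA -ac !mulgA bc.
have cccc : (c * c * (c * c) = 1)%g by rewrite -(gen_c4 gensG) !expgS expg0 mulg1 !mulgA.
apply: (split_L a) => e1; apply: (split_L b) => e2; apply: (split_L (c * c)%g) => e3.
apply: (Lw ((e1, e2, e3), _)); apply/and3P; split; apply/eqP => /=.
- by do 2![apply: eigen_part_stable => //]; apply: eigen_part_eigen.
- by apply: eigen_part_stable => //; apply: eigen_part_eigen.
- exact: eigen_part_eigen.
Qed.

(** Extending [form s] by arbitrary polynomial factors, the statement to prove is
    stable under multiplying these factors, which reduces it to linear forms
    and then to weight vectors. *)
Lemma forms_span (K : {mpoly F[n]} -> Prop) :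
    (forall k p, K p -> K (k *: p)) -> (forall p q, K p -> K q -> K (p + q)) ->
    (forall s, all weight_vector s -> K (form s)) ->
  forall p, K p.
Proof.
move=> KZ KD Kf p.
pose M q := forall s, all weight_vector s -> K (form s * q).
have M1 : M 1 by move=> s ws; rewrite mulr1; apply: Kf.
suff : forall q, M q -> M (p * q).
  by move/(_ 1 M1 [::] isT); rewrite /form big_nil mulr1 mul1r.
elim/lin_forms_generate: p => [|k p IHp|p1 p2 IH1 IH2|p1 p2 IH1 IH2|v] q Mq s ws.
- by rewrite mul1r; apply: Mq.
- by rewrite -scalerAl -scalerAr; apply: KZ; apply: IHp.
- by rewrite mulrDl mulrDr; apply: KD; [apply: IH1 | apply: IH2].
- by rewrite -mulrA; apply: IH1 => //; apply: IH2.
elim/weight_vectors_span: v => [k v Kv|u v Ku Kv|x wx].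
- by rewrite lin_formZ -scalerAl -scalerAr; apply: KZ.
- by rewrite lin_formD mulrDl mulrDr; apply: KD.
have := Mq (x :: s); rewrite /form big_cons /= wx => /(_ ws).
by rewrite mulrCA mulrA.
Qed.

(** Averaging successively over [a], [b], [c^2] and [c] multiplies an invariant
    by 16, while it sends a product of weight vectors to a multiple of its
    transfer if the weights sum to zero, and to 0 otherwise. *)
Lemma noether_bound : generated_upto rG 6.
Proof.
pose avg g q := q + act g q.
pose E q := avg c (avg (c * c)%g (avg b (avg a q))).
have avgZ g k q : avg g (k *: q) = k *: avg g q by rewrite /avg sym_actZ scalerDr.
have avgD g p q : avg g (p + q) = avg g p + avg g q by rewrite /avg sym_actD addrACA.
have EZ k q : E (k *: q) = k *: E q by rewrite /E (avgZ a) (avgZ b) (avgZ (c * c)%g) (avgZ c).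
have ED p q : E (p + q) = E p + E q by rewrite /E (avgD a) (avgD b) (avgD (c * c)%g) (avgD c).
have avg_inv g p : g \in G -> Defs.invariant rG p -> avg g p = 2%:R *: p.
  by move=> Gg Ip; rewrite /avg Ip // scaler_nat mulr2n.
move=> p Ip; have -> : p = (2%:R ^- 4) *: E p.
  rewrite /E (avg_inv a) // (avgZ b) (avg_inv b) // !(avgZ (c * c)%g).
  rewrite (avg_inv _ p Gcc) // !(avgZ c) (avg_inv c) // !scalerA -!mulrA.
  by rewrite [_^-1 * _](mulVf (expf_neq0 4 two_neq0)) scale1r.
apply: Sub_scale; elim/forms_span: p {Ip} => [k p Sp|p q Sp Sq|s ws].
- by rewrite EZ; apply: Sub_scale.
- by rewrite ED; apply: subalg_gen_add.
have [sa sb scc] := act_form ws; set w := \sum_(x <- s) x.1 in sa sb scc.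
have avg_sign g e : act g (form s) = (-1) ^+ e *: form s ->
    avg g (form s) = (~~ e).*2%:R *: form s.
  move=> se; rewrite /avg se; case: (e); first by rewrite scaleN1r subrr scale0r.
  by rewrite scale1r scaler_nat mulr2n.
have -> : E (form s) =
    (~~ w.1.1).*2%:R *: ((~~ w.1.2).*2%:R *: ((~~ w.2).*2%:R *: transfer (form s))).
  by rewrite /E (avg_sign _ _ sa) (avgZ b) (avg_sign _ _ sb) !(avgZ (c * c)%g)
    (avg_sign _ _ scc) !(avgZ c).
have [s0|] := boolP (zero_sum fst s).
  by do 3!apply: Sub_scale; apply: transfer_form_generated.
have Sub0 : Sub 0 by rewrite -(scale0r 1); apply: subalg_gen_scalar.
rewrite /zero_sum -/w.
by case: (w) => [[[] []] []] //= _; rewrite !(scale0r, scaler0).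
Qed.

End UpperBound.

(** * Representations from matrices satisfying the relations *)

Section VonDyck.

Variables (R : comUnitRingType) (gT : finGroupType) (G : {group gT}) (a b c : gT).
Variables (n : nat) (A B C : 'M[R]_n.+1).
Hypotheses (gensG : V4C4_gens G a b c) (AA : A ^+ 2 = 1) (BB : B ^+ 2 = 1).
Hypotheses (C4 : C ^+ 4 = 1) (AB : A * B = B * A) (AC : A * C = C * B) (BC : B * C = C * A).

(** The value on the normal form of [g]; the default value 1 is taken only
    outside the group. *)
Definition word_mx g : 'M[R]_n.+1 :=
  if [pick t : bool * bool * 'I_4 | g == (a ^+ t.1.1 * b ^+ t.1.2 * c ^+ t.2)%g]
  is Some t then A ^+ t.1.1 * B ^+ t.1.2 * C ^+ t.2 else 1.

Lemma word_mxE i j k :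
  word_mx (a ^+ i * b ^+ j * c ^+ k)%g = A ^+ i * B ^+ j * C ^+ k.
Proof.
rewrite /word_mx; case: pickP => [[[i' j'] k'] /eqP/(gen_free gensG)[ii' jj' kk']|].
  rewrite -(expr_mod i AA) -(expr_mod j BB) -(expr_mod k C4) ii' jj' kk'.
  by rewrite !expr_mod.
have [Ga Gb Gc] := And3 (gen_a gensG) (gen_b gensG) (gen_c gensG).
have /(gen_words gensG)[i' [j' [k' ->]]] : (a ^+ i * b ^+ j * c ^+ k \in G)%g.
  by apply: groupM; [apply: groupM|]; apply: groupX.
by move/(_ (i', j', k')); rewrite eqxx.
Qed.

Lemma gen_swap i j : (c * (a ^+ i * b ^+ j) = a ^+ j * b ^+ i * c)%g.
Proof.
have ca k : (c * a ^+ k = b ^+ k * c)%g.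
  elim: k => [|k IHk]; first by rewrite mulg1 mul1g.
  by rewrite expgSr mulgA IHk expgSr -!mulgA (gen_bc gensG).
have cb k : (c * b ^+ k = a ^+ k * c)%g.
  elim: k => [|k IHk]; first by rewrite mulg1 mul1g.
  by rewrite expgSr mulgA IHk expgSr -!mulgA (gen_ac gensG).
by rewrite mulgA ca -mulgA cb mulgA; congr (_ * c)%g; apply/commuteX2/esym/(gen_ab gensG).
Qed.

Lemma mx_swap i j : C * (A ^+ i * B ^+ j) = A ^+ j * B ^+ i * C.
Proof.
have ca k : C * A ^+ k = B ^+ k * C.
  elim: k => [|k IHk]; first by rewrite mulr1 mul1r.
  by rewrite exprSr mulrA IHk exprSr -!mulrA BC.
have cb k : C * B ^+ k = A ^+ k * C.
  elim: k => [|k IHk]; first by rewrite mulr1 mul1r.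
  by rewrite exprSr mulrA IHk exprSr -!mulrA AC.
by rewrite mulrA ca -mulrA cb mulrA; congr (_ * C); apply/commrX/commr_sym/commrX.
Qed.

(** Multiplicativity need only be checked for left multiplication by each
    generator, where a normal form is easily restored. *)
Lemma word_mx_repr : mx_repr G word_mx.
Proof.
split; first by have := word_mxE 0 0 0; rewrite !expr0 !expg0 !mulr1 !mulg1.
have step x X k h : (forall h, h \in G -> word_mx (x * h)%g = X * word_mx h) ->
    x \in G -> h \in G -> word_mx (x ^+ k * h)%g = X ^+ k * word_mx h.
  move=> xX Gx Gh; elim: k => [|k IHk]; first by rewrite mul1g mul1r.
  by rewrite expgS exprS -mulgA xX ?IHk ?mulrA // groupM // groupX.
have [Ga Gb Gc] := And3 (gen_a gensG) (gen_b gensG) (gen_c gensG).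
have stepA h : h \in G -> word_mx (a * h)%g = A * word_mx h.
  case/(gen_words gensG)=> i [j [k ->]].
  by rewrite !mulgA -expgS !word_mxE exprS !mulrA.
have stepB h : h \in G -> word_mx (b * h)%g = B * word_mx h.
  case/(gen_words gensG)=> i [j [k ->]]; rewrite word_mxE !mulgA !mulrA.
  have -> : (b * a ^+ i = a ^+ i * b)%g by apply/commuteX/esym/(gen_ab gensG).
  have -> : B * A ^+ i = A ^+ i * B by apply/commrX/esym.
  by rewrite -(mulgA (a ^+ i)%g) -(mulrA (A ^+ i)) -expgS -exprS word_mxE.
have stepC h : h \in G -> word_mx (c * h)%g = C * word_mx h.
  case/(gen_words gensG)=> i [j [k ->]]; rewrite word_mxE mulgA mulrA gen_swap mx_swap.
  by rewrite -(mulgA _ c) -(mulrA _ C) -expgS -exprS word_mxE.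
move=> g h Gg Gh; have [i [j [k ->]]] := gen_words gensG Gg.
have Gch := groupM (groupX k Gc) Gh; have Gbh := groupM (groupX j Gb) Gch.
rewrite word_mxE -!mulgA (step a A i _ stepA Ga Gbh) (step b B j _ stepB Gb Gch).
by rewrite (step c C k _ stepC Gc Gh) !mulrA.
Qed.

Lemma V4C4_von_dyck : exists rG : mx_representation R G n.+1,
  [/\ rG a = A, rG b = B & rG c = C].
Proof.
exists (MxRepresentation word_mx_repr); split=> /=.
- by have := word_mxE 1 0 0; rewrite !expr0 !expg0 !mulr1 !mulg1 expr1.
- by have := word_mxE 0 1 0; rewrite !expr0 !expg0 mulr1 mul1r mulg1 mul1g expr1.
- by have := word_mxE 0 0 1; rewrite !expr0 !expg0 !mul1r !mul1g expr1.
Qed.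

End VonDyck.

(** * Signed permutations of the variables *)

Section MonomialMatrices.

Variables (R : comUnitRingType) (n : nat).
Implicit Types (s t : 'I_n.+1 -> 'I_n.+1) (e f : 'I_n.+1 -> bool).

(** Rows are the images of the basis vectors, so [s] moves the indices of the
    variables. *)
Definition mono_mx s e : 'M[R]_n.+1 :=
  \matrix_(i, j) ((-1) ^+ e i *+ (s i == j)).

Lemma eq_mono_mx s t e f : s =1 t -> e =1 f -> mono_mx s e = mono_mx t f.
Proof. by move=> st ef; apply/matrixP=> i j; rewrite !mxE st ef. Qed.

Lemma mono_mx1 : mono_mx id (fun=> false) = 1.
Proof. by apply/matrixP=> i j; rewrite !mxE. Qed.

Lemma mono_mxM s t e f :
  mono_mx s e * mono_mx t f = mono_mx (t \o s) (fun i => e i (+) f (s i)).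
Proof.
apply/matrixP=> i j; rewrite !mxE (bigD1 (s i)) //= big1 => [|k].
  by rewrite !mxE eqxx addr0 mulr1n mulrnAr -signr_addb.
by rewrite !mxE eq_sym => /negPf ->; rewrite mul0r.
Qed.

End MonomialMatrices.

Section MonomialAction.

Variables (F : fieldType) (gT : finGroupType) (G : {group gT}).
Variables (n : nat) (rG : mx_representation F G n.+1).

Lemma sym_act_monomial g s e k : rG g = mono_mx F s e -> involutive s ->
  sym_act rG g 'X_[k] =
    (-1) ^+ (\sum_i e i * k i)%N *: 'X_[[multinom k (s i) | i < n.+1]].
Proof.
move=> def_g sK.
have act_var i : sym_act rG g 'X_i = (-1) ^+ e i *: 'X_(s i).
  rewrite sym_act_var (bigD1 (s i)) //= big1 => [|j].
    by rewrite def_g mxE eqxx addr0.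
  by rewrite def_g mxE eq_sym => /negPf ->; rewrite scale0r.
rewrite [X in sym_act _ _ X]mpolyXE_id sym_act_prod [in RHS]mpolyXE_id.
rewrite [X in _ *: X](reindex_inj (inv_inj sK)) /= -prodrXr -scaler_prod.
by apply: eq_bigr => i _; rewrite sym_actXn act_var exprZn -exprM mnmE sK.
Qed.

Lemma mcoeff_sym_act g s e p (m : 'X_{1..n.+1}) : rG g = mono_mx F s e -> involutive s ->
  (sym_act rG g p)@_m =
    (-1) ^+ (\sum_i e i * m (s i))%N * p@_[multinom m (s i) | i < n.+1].
Proof.
move=> def_g sK.
elim/mpolyind: p => [|k q p _ _ IHp].
  by rewrite -(scale0r 1) sym_actZ !scale0r !mcoeff0 mulr0.
rewrite sym_actD sym_actZ (sym_act_monomial _ def_g sK) !mcoeffD !mcoeffZ IHp mulrDr !mcoeffX.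
congr (_ + _); have [def_q|ne_qm] := eqVneq q [multinom m (s i) | i < n.+1].
  rewrite (_ : _ == m) ?mulr1; last by apply/eqP/mnmP=> i; rewrite mnmE def_q mnmE sK.
  by rewrite mulrC; congr (_ ^+ _ * _); apply: eq_bigr => i _; rewrite def_q mnmE.
rewrite (_ : (_ == m) = false) ?mulr0 //; apply: contraNF ne_qm => /eqP <-.
by apply/eqP/mnmP => i; rewrite !mnmE sK.
Qed.

(** The element [g] fixes the monomial up to the sign -1. *)
Lemma mcoeff_invariant_eq0 g s e p (m : 'X_{1..n.+1}) : 2 \notin [pchar F] ->
    g \in G -> rG g = mono_mx F s e -> involutive s ->
    [multinom m (s i) | i < n.+1] = m -> odd (\sum_i e i * m (s i)) ->
  Defs.invariant rG p -> p@_m = 0.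
Proof.
rewrite inE /= => two_neq0 Gg def_g sK ms odd_m Ip; apply/eqP.
have := mcoeff_sym_act p m def_g sK; rewrite Ip // ms -signr_odd odd_m mulN1r.
move/eqP; rewrite -subr_eq0 opprK -mulr2n -mulr_natl mulf_eq0.
by rewrite (negPf two_neq0).
Qed.

End MonomialAction.

(** * The lower bound *)

Section LowerBound.

Variables (F : fieldType) (gT : finGroupType) (G : {group gT}) (a b c : gT).
Hypotheses (charF : 2 \notin [pchar F]) (gensG : V4C4_gens G a b c).

(** The variables [x1], [x2], [y1], [y2] have the indices 0, 1, 2, 3. *)
Definition swap4 (i : 'I_4) : 'I_4 := inZp (if odd i then i.-1 else i.+1).

Definition mx_a : 'M[F]_4 := mono_mx F id (fun i => ~~ odd i).
Definition mx_b : 'M[F]_4 := mono_mx F id (fun i => odd i).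
Definition mx_c : 'M[F]_4 := mono_mx F swap4 (fun i => i == 3 :> nat).

Lemma swap4K : involutive swap4.
Proof. by case=> [[|[|[|[|//]]]] lt_i4]; apply: val_inj. Qed.

Lemma signed_permutation_rep_exists : exists rG : mx_representation F G 4,
  [/\ rG a = mx_a, rG b = mx_b & rG c = mx_c].
Proof.
have eq4 (s t : 'I_4 -> 'I_4) (e f : 'I_4 -> bool) :
    (forall i, s i = t i :> nat) -> e =1 f -> mono_mx F s e = mono_mx F t f.
  by move=> st; apply: eq_mono_mx => i; apply/val_inj/st.
apply: (V4C4_von_dyck gensG); rewrite ?expr2 ?exprS ?expr0 ?mulr1 !mono_mxM
  -?(mono_mx1 F 3); apply: eq4; by case=> [[|[|[|[|//]]]] lt_i4].
Qed.

Variable rG : mx_representation F G 4.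
Hypotheses (def_a : rG a = mx_a) (def_b : rG b = mx_b) (def_c : rG c = mx_c).

Definition exps k0 k1 k2 k3 : 'X_{1..4} := [multinom nth 0%N [:: k0; k1; k2; k3] i | i < 4].

Local Notation x0 := (@Ordinal 4 0 isT).
Local Notation x1 := (@Ordinal 4 1 isT).
Local Notation x2 := (@Ordinal 4 2 isT).
Local Notation x3 := (@Ordinal 4 3 isT).

Lemma exps_eqP (m : 'X_{1..4}) k0 k1 k2 k3 :
  m x0 = k0 -> m x1 = k1 -> m x2 = k2 -> m x3 = k3 -> m = exps k0 k1 k2 k3.
Proof.
move=> m0 m1 m2 m3; apply/mnmP=> i; rewrite mnmE.
case: i => [[|[|[|[|//]]]] lt_i4] /=; [rewrite -m0|rewrite -m1|rewrite -m2|rewrite -m3];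
  by congr (m _); apply: val_inj.
Qed.

Lemma sum4 (E : 'I_4 -> nat) : (\sum_i E i = E x0 + E x1 + E x2 + E x3)%N.
Proof.
rewrite !big_ord_recl big_ord0 addn0 !addnA.
by congr (_ + _ + _ + _)%N; congr E; apply: val_inj.
Qed.

(** The three parities are the coordinates of the weight of the monomial for
    [a], [b] and [c^2]. *)
Lemma mcoeff_odd_weight p (m : 'X_{1..4}) : Defs.invariant rG p ->
  [|| odd (m x0 + m x2), odd (m x1 + m x3) | odd (m x2 + m x3)] -> p@_m = 0.
Proof.
have [Ga Gb Gc] := And3 (gen_a gensG) (gen_b gensG) (gen_c gensG).
have def_cc : rG (c * c)%g = mono_mx F id (fun i => 1 < i)%N.
  rewrite repr_mxM // def_c [LHS]mono_mxM; apply: eq_mono_mx => [i|]; first exact: swap4K.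
  by case=> [[|[|[|[|//]]]] lt_i4].
have m_id : [multinom m i | i < 4] = m by apply/mnmP=> i; rewrite mnmE.
have m0 g e : g \in G -> rG g = mono_mx F id e -> odd (\sum_i e i * m i) ->
    Defs.invariant rG p -> p@_m = 0.
  by move=> Gg def_g; apply: (mcoeff_invariant_eq0 charF Gg def_g).
move=> Ip /or3P[] odd_m.
- by apply: (m0 _ _ Ga def_a _ Ip); rewrite sum4 /= !mul1n !mul0n !addn0.
- by apply: (m0 _ _ Gb def_b _ Ip); rewrite sum4 /= !mul1n !mul0n !addn0 !add0n.
- by apply: (m0 _ _ (groupM Gc Gc) def_cc _ Ip); rewrite sum4 /= !mul1n !mul0n !addn0 !add0n.
Qed.

(** The monomial [x1 x2 y1 y2] is [A]-invariant, but [c] changes its sign. *)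
Lemma mcoeff_ones p : Defs.invariant rG p -> p@_(exps 1 1 1 1) = 0.
Proof.
apply: (mcoeff_invariant_eq0 charF (gen_c gensG) def_c swap4K).
  by apply/mnmP; case=> [[|[|[|[|//]]]] lt_i4]; rewrite !mnmE.
by rewrite sum4 !mnmE.
Qed.

(** The factorizations of [x1^3 x2 y1 y2] into two [A]-invariant monomials are
    the trivial ones and [x1^2 * (x1 x2 y1 y2)]; in each of them one factor has
    coefficient 0. *)
Lemma mcoeff_top_mul p q : Defs.invariant rG p -> Defs.invariant rG q ->
  p@_(exps 3 1 1 1) = 0 -> q@_(exps 3 1 1 1) = 0 -> (p * q)@_(exps 3 1 1 1) = 0.
Proof.
move=> Ip Iq p0 q0; rewrite mcoeffM big1 // => -[u v] /= /eqP def_uv.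
have uv i : (u i + v i = nth 0 [:: 3; 1; 1; 1] i)%N by rewrite -mnmDE -def_uv mnmE.
have [] := boolP [|| odd (u x0 + u x2), odd (u x1 + u x3) | odd (u x2 + u x3)]%N.
  by move/(mcoeff_odd_weight Ip) => ->; rewrite mul0r.
have := (uv x0, uv x1, uv x2, uv x3); rewrite /= => -[[[uv0 uv1] uv2] uv3].
rewrite !negb_or => /and3P[e02 e13 e23].
have cases : [\/ u = exps 3 1 1 1 :> 'X_{1..4}, u = exps 1 1 1 1 :> 'X_{1..4},
                 v = exps 1 1 1 1 :> 'X_{1..4} | v = exps 3 1 1 1 :> 'X_{1..4}].
  have [u1|u1] : u x1 = 0%N \/ u x1 = 1%N by clear -uv1; lia.
    have [u0|u0] : u x0 = 0%N \/ u x0 = 2%N by clear -uv0 uv2 uv1 uv3 e02 e13 e23 u1; lia.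
      by apply: Or44; apply: exps_eqP; clear -uv0 uv2 uv1 uv3 e02 e13 e23 u1 u0; lia.
    by apply: Or43; apply: exps_eqP; clear -uv0 uv2 uv1 uv3 e02 e13 e23 u1 u0; lia.
  have [u0|u0] : u x0 = 1%N \/ u x0 = 3%N by clear -uv0 uv2 uv1 uv3 e02 e13 e23 u1; lia.
    by apply: Or42; apply: exps_eqP; clear -uv0 uv2 uv1 uv3 e02 e13 e23 u1 u0; lia.
  by apply: Or41; apply: exps_eqP; clear -uv0 uv2 uv1 uv3 e02 e13 e23 u1 u0; lia.
case: cases => ->; first by rewrite p0 mul0r.
- by rewrite mcoeff_ones // mul0r.
- by rewrite mcoeff_ones // mulr0.
- by rewrite q0 mulr0.
Qed.

Lemma degree_six_invariant : Defs.invariant rG ('X_[exps 3 1 1 1] - 'X_[exps 1 3 1 1]).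
Proof.
set f := _ - _; have sub g p q : sym_act rG g (p - q) = sym_act rG g p - sym_act rG g q.
  by rewrite -scaleN1r sym_actD sym_actZ scaleN1r.
have m_id (m : 'X_{1..4}) : [multinom m i | i < 4] = m by apply/mnmP=> i; rewrite mnmE.
have diag g e : rG g = mono_mx F id e ->
    (forall k0 k1, odd k0 -> odd k1 -> odd (\sum_i e i * exps k0 k1 1 1 i) = false) ->
    sym_act rG g f = f.
  move=> def_g even_e; rewrite sub !(sym_act_monomial _ def_g) // !m_id.
  by rewrite -2!(signr_odd F (\sum_i _)) !even_e // !scale1r.
apply: (invariant_gens gensG).
- apply: (diag _ _ def_a) => k0 k1 ok0 ok1.
  by rewrite sum4 !mnmE /= !mul1n !mul0n !addn0 oddD ok0.
- apply: (diag _ _ def_b) => k0 k1 ok0 ok1.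
  by rewrite sum4 !mnmE /= !mul1n !mul0n !addn0 oddD ok1.
have swap_exps k0 k1 : [multinom exps k0 k1 1 1 (swap4 i) | i < 4] = exps k1 k0 1 1.
  by apply: exps_eqP; rewrite !mnmE.
rewrite sub !(sym_act_monomial _ def_c swap4K) !swap_exps !sum4 !mnmE /=.
by rewrite !mul0n !add0n !muln1 !expr1 !scaleN1r opprK addrC.
Qed.

Lemma noether_lower_bound d : generated_upto rG d -> (6 <= d)%N.
Proof.
move=> gen; rewrite leqNgt; apply/negP=> lt_d6.
have deg6 : mdeg (exps 3 1 1 1) = 6 by rewrite mdegE sum4 !mnmE.
suff : ('X_[exps 3 1 1 1] - 'X_[exps 1 3 1 1] : {mpoly F[4]})@_(exps 3 1 1 1) = 0.
  rewrite mcoeffB !mcoeffX eqxx (_ : _ == _ = false) ?subr0 => [/eqP|].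
    by rewrite oner_eq0.
  by apply/eqP=> /mnmP/(_ x0); rewrite !mnmE.
suff H p : subalg_gen (fun q =>
      Defs.invariant rG q /\ exists2 k, (k <= d)%N & q \is k.-homog) p ->
    Defs.invariant rG p /\ p@_(exps 3 1 1 1) = 0.
  by case: (H _ (gen _ degree_six_invariant)).
elim=> [q [Iq [k le_kd hq]]|k|q r _ [Iq q0] _ [Ir r0]|q r _ [Iq q0] _ [Ir r0]].
- have ne_k : mdeg (exps 3 1 1 1) != k.
    by rewrite deg6 gtn_eqF // (leq_ltn_trans le_kd).
  by split=> //; apply: dhomog_nemf_coeff ne_k.
- split; first exact: invariantC.
  rewrite mcoeffZ mcoeff1 (_ : _ == _ = false) ?mulr0 //.
  by apply/eqP=> /(congr1 mdeg); rewrite deg6 mdeg0.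
- by split; [apply: invariantD | rewrite mcoeffD q0 r0 addr0].
- by split; [apply: invariantM | apply: mcoeff_top_mul].
Qed.

End LowerBound.

Theorem proposition3p10 (F : fieldType) (gT : finGroupType) (G : {group gT})
    (charF : (2 \notin [pchar F]%R)%N)
    (defG : is_V4_sdprod_C4 G) :
  is_noether_number F G 6.
Proof.
have [a [b [c gensG]]] := V4C4_gensP defG.
have le6 n (rG : mx_representation F G n) : generated_upto rG 6.
  by move=> p; apply: (noether_bound charF gensG).
split=> [n rG|m' le_m']; first exact: beta_exists (le6 n rG).
have [rG [def_a def_b def_c]] := signed_permutation_rep_exists F gensG.
have [d beta_d _] := beta_exists (le6 _ rG).
apply: leq_trans (le_m' _ rG d beta_d); case: beta_d => gen_d _.
exact: (noether_lower_bound charF gensG def_a def_b def_c gen_d).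
Qed.
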